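(* Let $\lambda$ be the standard Bernoulli measure on the Cantor set in $[0,+\infty)$. (1) For every $p>1$ and every non-negative measurable function $f$ on $[0,+\infty)$, $$\int_0^{+\infty}\left(\frac{1}{\lambda([0,x])}\int_0^x f(t)\,\lambda(dt)\right)^p\lambda(dx)\leq\left(\frac{p}{p-1}\right)^p\int_0^{+\infty}f(x)^p\,\lambda(dx).$$ (2) For every $1<p<q<+\infty$, there is no finite constant $A$ such that $$\left[\int_0^{+\infty}\left(\frac{1}{\lambda([0,x])}\int_0^x f(t)\,\lambda(dt)\right)^q\lambda(dx)\right]^{1/q}\leq A\left[\int_0^{+\infty}f(x)^p\,\lambda(dx)\right]^{1/p}$$ holds for all non-negative measurable functions $f$ on $[0,+\infty)$. (3) For every $1<p\leq q<+\infty$, there is no finite constant $A$ such that $$\left[\int_0^{+\infty}\left(\frac{1}{x}\int_0^x f(t)\,dt\right)^q\lambda(dx)\right]^{1/q}\leq A\left[\int_0^{+\infty}f(x)^p\,dx\right]^{1/p}$$ holds for all non-negative measurable functions $f$ on $[0,+\infty)$.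
   Context: The standard Bernoulli measure is defined as follows. For $m\ge 0$ let $\Omega^m=\{0,1\}^{m+1}$, with elements written $(x_0,x_1,\dots,x_m)$, let $\rho_m$ be the uniform probability measure on $\Omega^m$, and let $J:\Omega^m\to[0,1]$, $J(x)=a_0^mx_0+a_1^mx_1+\cdots+a_m^mx_m$, where $a_k^m=3^{-m}b_k$, $b_0=1$, $b_k=2\cdot3^{k-1}$ for $k\ge1$. Let $K_m=J(\Omega^m)$. The closure of $\bigcup_{m\ge0}K_m$ is the Cantor set $\mathbb{K}\subset[0,1]$. Let $\lambda_m=\rho_m\circ J^{-1}$, so that $\lambda_m(\{p\})=2^{-(m+1)}$ for each $p\in K_m$. There is a unique probability measure on $\mathbb{K}$ to which $\lambda_m$ converges weakly, i.e. $\int_{K_m}f\,d\lambda_m$ converges to the integral of $f$ over $\mathbb{K}$ for all $f\in C(\mathbb{K})$; it is called the standard Bernoulli (probability) measure on $\mathbb{K}$. The Cantor set in $[0,+\infty)$ is $\widetilde{\mathbb{K}}=\bigcup_{n=0}^{+\infty}(n+\mathbb{K})$, and $\lambda$ denotes the extension of the standard Bernoulli measure to $\widetilde{\mathbb{K}}$, i.e. the measure on $[0,+\infty)$ which is the sum over $n\geq0$ of the translates by $n$ of the standard Bernoulli probability measure on $\mathbb{K}$. *)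

(* Defs.v *)
From HB Require Import structures.
From mathcomp Require Import all_boot all_order all_algebra.
From mathcomp Require Import all_classical all_reals all_analysis measurable_realfun.
Import Order.TTheory GRing.Theory Num.Theory.
Import numFieldNormedType.Exports.

Set Implicit Arguments.
Unset Strict Implicit.
Unset Printing Implicit Defensive.

Local Open Scope classical_set_scope.
Local Open Scope ring_scope.

(* {0,1}^(m+1), with the product of the discrete sigma-algebras of bool. *)
Notation Omega m := (m.+1.-tuple bool).

Section Cantor.
Variable R : realType.

Definition weight (k : nat) : R := if k is k'.+1 then 2 * 3 ^+ k' else 1.

Definition coef (m k : nat) : R := 3 ^- m * weight k.

Definition J (m : nat) (x : Omega m) : measurableTypeR R :=
  \sum_(k < m.+1) coef m k * (tnth x k)%:R.

Lemma measurable_J m : measurable_fun setT (@J m).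
Proof.
apply: measurable_sum => k; apply: measurable_funM => //.
apply: (measurableT_comp (f := fun b : bool => (b%:R : R))) => //.
exact: measurable_tnth.
Qed.

HB.instance Definition _ m :=
  isMeasurableFun.Build _ _ _ _ (@J m) (@measurable_J m).

(* The 2^(m+1) endpoints of the 2^m intervals of length 3^-m which form the
   m-th stage of the middle-thirds construction. *)
Definition Kfin (m : nat) : set R := range (@J m).

Definition Cantor_set : set R := closure (\bigcup_m Kfin m).

Definition rho (m : nat) : set (Omega m) -> \bar R :=
  mscale (2 ^- m.+1)%:nng (@counting (Omega m) R).

Arguments rho : clear implicits.

HB.instance Definition _ m := Measure.on (rho m).

Lemma rho_setT m : rho m setT = 1%E.
Proof.
rewrite /rho /= /mscale /= /counting asboolT; last exact: finite_finset.
have /perm_size -> : perm_eq (finmap.enum_fset (fset_set [set: Omega m])) (enum {: Omega m}).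
  apply: uniq_perm; [exact: finmap.fset_uniq|exact: enum_uniq|] => x.
  rewrite in_fset_set; last exact: finite_finset.
  by rewrite mem_enum in_setT.
by rewrite -cardE card_tuple card_bool natrX -EFinM mulVf// expf_neq0.
Qed.

HB.instance Definition _ m :=
  Measure_isProbability.Build _ _ _ (rho m) (rho_setT m).

Definition lambda_fin (m : nat) : probability (measurableTypeR R) R :=
  distribution (rho m) (@J m).

(* A probability measure on the Cantor set is a Borel probability measure on R
   giving mass 1 to it; C(K) consists of the restrictions to K of the
   functions R -> R that are continuous within K. *)
Definition standard_Bernoulli (mu : probability (measurableTypeR R) R) : Prop :=
  mu Cantor_set = 1%E /\
  forall f : R -> R, {within Cantor_set, continuous f} ->
    (\int[lambda_fin m]_(x in Kfin m) (f x)%:E)%E @[m --> \oo] -->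
    (\int[mu]_(x in Cantor_set) (f x)%:E)%E.

Definition shift_right (n : nat) (x : measurableTypeR R) : measurableTypeR R :=
  x + n%:R.

Lemma measurable_shift_right n : measurable_fun setT (shift_right n).
Proof. exact: measurable_funD. Qed.

HB.instance Definition _ n :=
  isMeasurableFun.Build _ _ _ _ (shift_right n) (measurable_shift_right n).

(* A measure on R carried by [0, +oo[. *)
Definition Bernoulli_ext (mu : probability (measurableTypeR R) R) :
    set (measurableTypeR R) -> \bar R :=
  mseries (fun n => distribution mu (shift_right n)) 0.

HB.instance Definition _ mu := Measure.on (Bernoulli_ext mu).

End Cantor.

(* Main.v *)
Require Import Defs.
From HB Require Import structures.
From mathcomp Require Import all_boot all_order all_algebra.
From mathcomp Require Import all_classical all_reals all_analysis.
From mathcomp Require Import measurable_realfun.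
From mathcomp Require Import ring lra.
Import Order.TTheory GRing.Theory Num.Theory.
Import numFieldNormedType.Exports.

(** Write F for the distribution function of mu (the Cantor function) and G for
    that of its periodic extension lambda to the half-line, so that
    G x = lambda([0, x]) = sum of F (x - n) over n.

    Everything about mu comes from self-similarity. Appending a digit to a word
    shows that the (m+1)-st finite measure is the average of the images of the
    m-th one under x / 3 and (x + 2) / 3. Testing weak convergence on
    piecewise linear ramps and letting their width tend to 0 turns this into
    the functional equation 2 F(x) = F(3x) + F(3x - 2)
    ([Bernoulli_cdf_selfsimilar]). Iterating it gives F(3^-n) = 2^-n and, since
    a short interval meets only one of the two halves of the Cantor set, a
    modulus of continuity: F increases by at most 2^-m over a length of 3^-m.
    Hence G is continuous, and it is unbounded because each copy of the Cantor
    set has mass 1.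

    Part (1) holds for every measure lambda whose distribution function G is
    continuous and unbounded: such a G pushes lambda forward to Lebesgue
    measure ([pushforward_distribution_function]), so integrals of powers of G
    are those of powers of u on the line. With s = (p - 1) / p, Hoelder's
    inequality for f = (f G^(s/p)) G^(-s/p) bounds the p-th power of the
    average by s^(1-p) G(x)^(-s-1) times the integral of f^p G^s over ]0, x];
    exchanging the integrals, and integrating G^(-s-1) over [t, +oo[ to at
    most G(t)^-s / s, gives the constant s^-p = (p / (p - 1))^p.

    For parts (2) and (3), take f to be the indicator of [0, 3^-n]. Its averages
    are 1 on ]0, 3^-n], so the left-hand side is at least 2^(-n/q), while the
    norm of f is 2^(-n/p) for lambda and 3^(-n/p) for Lebesgue measure. Both
    ratios grow geometrically with n. *)

Set Implicit Arguments.
Unset Strict Implicit.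
Unset Printing Implicit Defensive.

Local Open Scope classical_set_scope.
Local Open Scope ring_scope.
Local Open Scope ereal_scope.

(** * Self-similarity of the finite stages *)

(** The last digit carries the largest weight in [J]. Appending there rescales
    all the others by 1/3, which prepending would not do: the first digit has
    the exceptional weight 1. *)
Definition snoc_word m (p : Omega m * bool) : Omega m.+1 :=
  [tuple of rcons p.1 p.2].

Lemma snoc_word_bij m : bijective (@snoc_word m).
Proof.
exists (fun x : Omega m.+1 => ([tuple tnth x (widen_ord (leqnSn _) k) | k < m.+1],
  tnth x ord_max)).
- move=> [y b]; congr pair.
    apply: eq_from_tnth => k; rewrite tnth_mktuple (tnth_nth false) /=.
    by rewrite nth_rcons size_tuple ltn_ord -tnth_nth.
  by rewrite (tnth_nth false) /= nth_rcons size_tuple ltnn eqxx.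
- move=> x; apply: eq_from_tnth => k; rewrite (tnth_nth false) /= nth_rcons size_map size_enum_ord.
  case: ltnP => km.
    have -> : k = widen_ord (leqnSn _) (Ordinal km) by exact: val_inj.
    by rewrite -[RHS](tnth_mktuple (fun j : 'I_m.+1 => tnth x (widen_ord _ j))
      (Ordinal km)) (tnth_nth false).
  have {2}-> : k = ord_max by apply: val_inj => /=; apply/eqP; rewrite eqn_leq km -ltnS ltn_ord.
  by rewrite eqn_leq km -ltnS ltn_ord.
Qed.

Lemma J_snoc (R : realType) m (y : Omega m) (b : bool) :
  J R (snoc_word (y, b)) = ((J R y + 2 * b%:R) / 3)%R.
Proof.
rewrite /J big_ord_recr /= mulrDl mulr_suml; congr (_ + _)%R.
  apply: eq_bigr => k _; rewrite (tnth_nth false) /= nth_rcons size_tuple ltn_ord -tnth_nth.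
  rewrite /coef exprS invfM; ring.
rewrite (tnth_nth false) /= nth_rcons size_tuple ltnn eqxx /coef /weight exprS.
by field; rewrite expf_neq0.
Qed.

(** The integral of f against the m-th finite measure, as a finite sum. *)
Definition word_mean (R : realType) m (f : R -> R) : R :=
  (2 ^- m.+1 * \sum_(x : Omega m) f (J R x))%R.

(** Conditioning on the last digit: the two values of this digit select the two
    contractions onto the thirds of the unit interval. *)
Lemma word_meanS (R : realType) m (f : R -> R) :
  word_mean m.+1 f = ((word_mean m (fun x => f (x / 3)) +
    word_mean m (fun x => f ((x + 2) / 3))) / 2)%R.
Proof.
rewrite /word_mean (reindex (@snoc_word m)) /=; last exact/onW_bij/snoc_word_bij.
transitivity (2 ^- m.+2 * \sum_(p : Omega m * bool) f ((J R p.1 + 2 * p.2%:R) / 3))%R.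
  by congr (_ * _)%R; apply: eq_bigr => -[y b] _; rewrite J_snoc.
rewrite -(pair_bigA _ (fun y b => f ((J R y + 2 * (b : bool)%:R) / 3)%R)) /=.
under eq_bigr do rewrite big_bool /= mulr0 addr0 mulr1.
rewrite big_split /= exprS invfM; ring.
Qed.

Lemma measurable_word1 m (y : Omega m) : measurable [set y].
Proof.
rewrite (_ : [set y] = \bigcap_(k in [set: 'I_m.+1])
    (@tnth m.+1 bool ^~ k) @^-1` [set tnth y k]); last first.
  apply/seteqP; split => [_ -> k _ //|x xy]; apply: eq_from_tnth => k; exact: xy.
apply: fin_bigcap_measurable => // k _; rewrite -[X in measurable X]setTI.
exact: measurable_tnth.
Qed.

Lemma integral_lambda_fin (R : realType) m (f : R -> R) :
  measurable_fun setT f -> (forall x, 0 <= f x)%R ->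
  \int[lambda_fin R m]_(x in Kfin m) (f x)%:E = (word_mean m f)%:E.
Proof.
move=> mf f0.
have mK : measurable (@Kfin R m : set (measurableTypeR R)).
  apply: countable_measurable => [x|]; first exact: measurable_set1.
  by apply: finite_set_countable; exact: finite_image.
rewrite /lambda_fin ge0_integral_pushforward //; last 2 first.
- by apply/measurable_EFinP; exact: measurable_funS mf.
- by move=> x _; rewrite lee_fin.
rewrite (_ : _ @^-1` _ = setT); last by apply/seteqP; split => [//|x _] ; exists x.
have mfJ : measurable_fun setT (EFin \o f \o @J R m).
  by apply: measurableT_comp; [exact/measurable_EFinP|exact: measurable_J].
rewrite ge0_integral_mscale //=; last by move=> *; rewrite lee_fin.
rewrite (_ : setT = \big[setU/set0]_(x <- enum {: Omega m}) [set x]); last first.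
  by apply/seteqP; split => // x _; rewrite -bigcup_seq; exists x => //=; rewrite mem_enum.
rewrite ge0_integral_bigsetU //=; last 5 first.
- by move=> x; exact: measurable_word1.
- exact: enum_uniq.
- by move=> x y _ _ [z [/= <- <-]].
- exact: measurable_funS mfJ.
- by move=> *; rewrite lee_fin.
rewrite /word_mean EFinM -sumEFin big_enum /=; congr (_ * _); apply: eq_bigr => x _.
rewrite (eq_integral (cst (f (J R x))%:E)); last by move=> y /[!inE] ->.
rewrite integral_cst //; last exact: measurable_word1.
by rewrite /= /counting asboolT // fset_set1 finmap.cardfs1 mule1.
Qed.

Lemma J_itv (R : realType) m (x : Omega m) : (0 <= (J R x : R) <= 1)%R.
Proof.
elim: m => [|m IHm] in x *.
  rewrite /J big_ord1 /coef /weight expr0 invr1 !mul1r.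
  by case: (tnth x ord0); rewrite !(lexx, ler01).
have [g _ gK] := @snoc_word_bij m.
rewrite -(gK x); case: (g x) => y b; rewrite J_snoc.
have /andP[y0 y1] := IHm y.
have [b0 b1] : (0 <= b%:R :> R)%R /\ (b%:R <= 1 :> R)%R.
  by case: (b); rewrite /= !(lexx, ler01).
by apply/andP; split; lra.
Qed.

Lemma Cantor_set_itv (R : realType) : @Cantor_set R `<=` `[0%R, 1%R]%classic.
Proof.
rewrite /Cantor_set closureE => x; apply; split; first exact: itv_closed.
by move=> _ [m _ [y _ <-]]; rewrite /= in_itv /= J_itv.
Qed.

(** * The functional equation of the Cantor function *)

(** A continuous upper approximation, up to the distance e, of the indicator of
    ]-oo, c]: weak convergence says nothing about the indicator itself. *)
Definition ramp (R : realType) (c e x : R) : R :=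
  Num.max 0%R (Num.min 1%R ((c + e - x) / e)%R).

Lemma ramp_ge0 (R : realType) (c e x : R) : (0 <= ramp c e x)%R.
Proof. by rewrite /ramp le_max lexx. Qed.

Lemma ramp_le1 (R : realType) (c e x : R) : (ramp c e x <= 1)%R.
Proof. by rewrite /ramp ge_max ler01 ge_min lexx. Qed.

Lemma ramp1 (R : realType) (c e x : R) : (0 < e)%R -> (x <= c)%R -> ramp c e x = 1%R.
Proof.
move=> e0 xc; rewrite /ramp min_l ?max_r //.
by rewrite ler_pdivlMr // mul1r; lra.
Qed.

Lemma ramp0 (R : realType) (c e x : R) : (0 < e)%R -> (c + e <= x)%R -> ramp c e x = 0%R.
Proof.
move=> e0 xc; have h : ((c + e - x) / e <= 0)%R by rewrite pmulr_lle0 ?invr_gt0 //; lra.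
by rewrite /ramp max_l // ge_min h orbT.
Qed.

Lemma continuous_ramp (R : realType) (c e : R) : continuous (ramp c e).
Proof.
move=> x.
apply: (@continuous_max _ _ (cst 0%R) (cst 1%R \min (fun y => (c + e - y) / e)%R)).
  exact: cst_continuous.
apply: continuous_min; first exact: cst_continuous.
apply: cvgMr_tmp; apply: cvgB; first exact: cvg_cst.
exact: cvg_id.
Qed.

(** The family of ramps is stable under the contractions, so the recursion for
    finite means only moves the parameters. *)
Lemma ramp_scale (R : realType) (c e a x : R) : (0 < e)%R ->
  ramp c e ((x + a) / 3)%R = ramp (3 * c - a)%R (3 * e)%R x.
Proof.
move=> e0; rewrite /ramp; congr (Num.max _ (Num.min _ _)).
by field; rewrite gt_eqF.
Qed.

Lemma exists_pow2_lt (R : realType) (d : R) : (0 < d)%R -> exists m, (2 ^- m < d)%R.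
Proof.
move=> d0; exists (Num.bound d^-1); rewrite invf_plt ?posrE ?exprn_gt0 //.
apply: lt_trans (archi_boundP _) _; first by rewrite invr_ge0 ltW.
by rewrite -natrX ltr_nat ltn_expl.
Qed.

Section cdf_of_Bernoulli.
Variables (R : realType) (mu : probability (measurableTypeR R) R).

(** For the standard Bernoulli measure, this is the Cantor function. *)
Definition Bernoulli_cdf (x : R) : R := fine (mu `]-oo, x]%classic).
Local Notation F := Bernoulli_cdf.

Lemma Bernoulli_cdfE x : (F x)%:E = mu `]-oo, x]%classic.
Proof. by rewrite /F fineK // fin_num_measure. Qed.

Lemma Bernoulli_cdf_ge0 x : (0 <= F x)%R.
Proof. exact: fine_ge0. Qed.

Lemma Bernoulli_cdf_le1 x : (F x <= 1)%R.
Proof. by rewrite -lee_fin Bernoulli_cdfE probability_le1. Qed.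

Lemma Bernoulli_cdf_nd : {homo F : x y / (x <= y)%R}.
Proof.
move=> x y xy; rewrite -lee_fin !Bernoulli_cdfE le_measure ?inE //.
by apply: subset_itvl; rewrite bnd_simp.
Qed.

(** Right continuity, in the form in which the width of a ramp is chosen. *)
Lemma Bernoulli_cdf_right x d : (0 < d)%R ->
  exists2 e, (0 < e)%R & (F (x + e) <= F x + d)%R.
Proof.
move=> d0.
pose iT : measurableTypeR R -> R := idfun.
pose X : {RV mu >-> R} := HB.pack iT
  (@isMeasurableFun.Build _ _ _ _ iT (@measurable_id _ _ setT)).
have /fine_cvg : cdf X y @[y --> x^'+] --> (F x)%:E.
  by rewrite Bernoulli_cdfE; exact: cdf_right_continuous.
move/cvgrPdist_le => /(_ d d0) [e /= e0 he]; exists (e / 2)%R; first by rewrite divr_gt0.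
have := he (x + e / 2)%R; rewrite /= opprD addNKr normrN gtr0_norm ?divr_gt0 //.
move=> /(_ _ _) H.
have : (`|F x - F (x + e / 2)| <= d)%R by apply: H; lra.
by rewrite ler_norml => /andP[]; lra.
Qed.

Hypothesis Hmu : standard_Bernoulli mu.

Lemma measurable_Cantor_set : measurable (@Cantor_set R : set (measurableTypeR R)).
Proof. by apply: closed_measurable; exact: closed_closure. Qed.

Lemma mu_setC_Cantor : mu (~` (@Cantor_set R)) = 0.
Proof.
have [mK _] := Hmu.
by rewrite probability_setC ?mK ?subee //; exact: measurable_Cantor_set.
Qed.

Lemma Bernoulli_cdf_lt0 x : (x < 0)%R -> F x = 0%R.
Proof.
move=> x0; apply/eqP; rewrite eq_le Bernoulli_cdf_ge0 andbT -lee_fin Bernoulli_cdfE.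
apply: (@le_trans _ _ (mu (~` (@Cantor_set R)))); last by rewrite mu_setC_Cantor.
rewrite le_measure ?inE //.
  by apply: measurableC; exact: measurable_Cantor_set.
move=> y /=; rewrite in_itv /= => yx /Cantor_set_itv /=; rewrite in_itv /= => /andP[y0 _]; lra.
Qed.

Lemma Bernoulli_cdf_ge1 x : (1 <= x)%R -> F x = 1%R.
Proof.
move=> x1; apply/eqP; rewrite eq_le Bernoulli_cdf_le1 -lee_fin Bernoulli_cdfE.
have [mK _] := Hmu; rewrite -[X in X <= _]mK.
rewrite le_measure ?inE //; first exact: measurable_Cantor_set.
by move=> y /Cantor_set_itv /=; rewrite !in_itv /= => /andP[_ y1]; lra.
Qed.

Let L (f : R -> R) := fine (\int[mu]_(x in @Cantor_set R) (f x)%:E).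

(** Integrating over the Cantor set loses nothing, as its complement is
    negligible; the pointwise comparison of a ramp with the indicators of
    ]-oo, c] and ]-oo, c + e] then gives both bounds. *)
Lemma ramp_bounds c e : (0 < e)%R ->
  (F c)%:E <= \int[mu]_(x in @Cantor_set R) (ramp c e x)%:E <= (F (c + e))%:E.
Proof.
move=> e0; have mK := measurable_Cantor_set.
have muK A : measurable A -> \int[mu]_(x in @Cantor_set R) (\1_A x)%:E = mu A.
  move=> mA; rewrite integral_indic // [RHS](measureDI _ mA mK).
  rewrite [X in X + _](_ : _ = 0) ?add0e //.
  apply: (subset_measure0 _ _ _ mu_setC_Cantor) => [| |x []//].
  - exact: measurableD.
  - exact: measurableC.
have mR : measurable_fun (@Cantor_set R) (fun x => (ramp c e x)%:E).
  apply/measurable_EFinP; apply: measurable_funTS.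
  by apply: continuous_measurable_fun; exact: continuous_ramp.
have mI b : measurable_fun (@Cantor_set R) (fun x => (\1_`]-oo, b]%classic x)%:E : \bar R).
  by apply/measurable_EFinP/measurable_funTS.
rewrite !Bernoulli_cdfE -!muK //; apply/andP; split.
  apply: ge0_le_integral; [exact: mK|by move=> x _; rewrite lee_fin|
    exact: (mI c)|exact: mR|move=> x _].
  rewrite lee_fin indicE mem_setE in_itv /=.
  by case: (lerP (x : R) c) => xc; rewrite ?ramp_ge0 // ramp1.
apply: ge0_le_integral; [exact: mK|by move=> x _; rewrite lee_fin ramp_ge0|
  exact: mR|exact: (mI (c + e)%R)|move=> x _].
rewrite lee_fin indicE mem_setE in_itv /=.
by case: (lerP (x : R) (c + e)) => xc; rewrite ?ramp_le1 // ramp0 // ltW.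
Qed.

Lemma word_mean_cvg (f : R -> R) : continuous f -> (forall x, 0 <= f x <= 1)%R ->
  word_mean m f @[m --> \oo] --> L f.
Proof.
move=> cf f01; have mf := continuous_measurable_fun cf.
have f0 x : (0 <= f x)%R by have /andP[] := f01 x.
have [_ /(_ f (continuous_subspaceT cf))] := Hmu.
under eq_fun do rewrite integral_lambda_fin //.
rewrite -[X in _ --> X]fineK; first exact: (@fine_cvg _ _ _ _ (fun m => (word_mean m f)%:E)).
rewrite ge0_fin_numE; last by apply: integral_ge0 => x _; rewrite lee_fin.
apply: (@le_lt_trans _ _ (\int[mu]_(x in @Cantor_set R) (cst 1 x))); last first.
  rewrite integral_cst ?mul1e; last exact: measurable_Cantor_set.
  exact: (le_lt_trans (probability_le1 _ measurable_Cantor_set) (ltry _)).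
apply: ge0_le_integral => //.
- exact: measurable_Cantor_set.
- by move=> x _; rewrite lee_fin.
- exact/measurable_EFinP/measurable_funTS.
- by move=> x _; rewrite lee_fin; have /andP[] := f01 x.
Qed.

(** In the limit, the recursion [word_meanS] holds for the integrals of ramps
    against mu; as the width of the ramps tends to 0, right continuity of F
    replaces these integrals by values of F. *)
Lemma Bernoulli_cdf_selfsimilar x : F x = ((F (3 * x) + F (3 * x - 2)) / 2)%R.
Proof.
have LE c e : (0 < e)%R -> L (ramp c e) =
    ((L (ramp (3 * c) (3 * e)) + L (ramp (3 * c - 2) (3 * e))) / 2)%R.
  move=> e0.
  have c1 c' e' := @word_mean_cvg _ (@continuous_ramp R c' e')
    (fun x => introT andP (conj (ramp_ge0 c' e' x) (ramp_le1 c' e' x))).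
  have wS m : word_mean m.+1 (ramp c e) = ((word_mean m (ramp (3 * c) (3 * e)) +
      word_mean m (ramp (3 * c - 2) (3 * e))) / 2)%R.
    rewrite word_meanS; congr ((word_mean _ _ + word_mean _ _) / 2)%R; apply/funext => t.
      by rewrite -[X in (X / 3)%R]addr0 ramp_scale // subr0.
    by rewrite ramp_scale.
  have c2 : word_mean m.+1 (ramp c e) @[m --> \oo] --> L (ramp c e).
    by rewrite (cvg_shiftS (fun m => word_mean m (ramp c e))).
  apply: (@cvg_unique _ (@Rhausdorff R) _ _ _ _ c2); rewrite (funext wS).
  by apply: cvgMr_tmp; apply: cvgD; exact: c1.
have LF c e : (0 < e)%R -> (F c <= L (ramp c e) <= F (c + e))%R.
  move=> e0; have := ramp_bounds c e0.
  by rewrite /L; case: (integral _ _ _) => [r| |] //= /andP[].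
apply/eqP; rewrite eq_le; apply/andP; split; apply/ler_addgt0Pr => d d0.
  have [e1 e10 h1] := Bernoulli_cdf_right (3 * x) d0.
  have [e2 e20 h2] := Bernoulli_cdf_right (3 * x - 2) d0.
  (* the ramps on the right-hand side have width 3 * e *)
  pose e := (Num.min e1 e2 / 3)%R.
  have e0 : (0 < e)%R by rewrite divr_gt0 // lt_min e10.
  have e3 : (0 < 3 * e)%R by rewrite mulr_gt0.
  have ee1 : (3 * e <= e1)%R by rewrite /e mulrC divfK // ge_min lexx.
  have ee2 : (3 * e <= e2)%R by rewrite /e mulrC divfK // ge_min lexx orbT.
  have /andP[+ _] := LF x e e0; rewrite LE //.
  have /andP[_] := LF (3 * x)%R _ e3.
  have /andP[_] := LF (3 * x - 2)%R _ e3.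
  have : (F (3 * x + 3 * e) <= F (3 * x + e1))%R by apply: Bernoulli_cdf_nd; lra.
  have : (F (3 * x - 2 + 3 * e) <= F (3 * x - 2 + e2))%R by apply: Bernoulli_cdf_nd; lra.
  lra.
have [e e0 h] := Bernoulli_cdf_right x d0.
have e3 : (0 < 3 * e)%R by rewrite mulr_gt0.
have /andP[_] := LF x e e0; rewrite LE //.
have /andP[+ _] := LF (3 * x)%R _ e3.
have /andP[+ _] := LF (3 * x - 2)%R _ e3.
lra.
Qed.

(** At 3^-(m+1) the second term of the functional equation vanishes, since
    3^-m - 2 is negative. *)
Lemma Bernoulli_cdf_pow3 m : F (3 ^- m) = (2 ^- m)%R.
Proof.
elim: m => [|m IHm]; first by rewrite !expr0 !invr1 Bernoulli_cdf_ge1.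
have e1 : (3 * 3 ^- m.+1 = 3 ^- m :> R)%R by rewrite exprS invfM mulrA divff // mul1r.
rewrite Bernoulli_cdf_selfsimilar e1 IHm Bernoulli_cdf_lt0 ?addr0; last first.
  have : (3 ^- m <= 1 :> R)%R by rewrite invf_le1 ?exprn_gt0 // exprn_ege1 // ler1n.
  lra.
by rewrite exprS invfM mulrC.
Qed.

(** The functional equation triples the interval [x, y]. The tripled interval
    has length at most 1, so it cannot cross ]1, 2[: one of the two terms is
    constant on it, and only half of the increment of the other remains. *)
Lemma Bernoulli_cdf_modulus m (x y : R) : (x <= y)%R -> (y - x <= 3 ^- m)%R ->
  (F y - F x <= 2 ^- m)%R.
Proof.
elim: m x y => [|m IHm] x y xy.
  rewrite expr0 invr1 => _.
  have := Bernoulli_cdf_ge0 x; have := Bernoulli_cdf_le1 y; lra.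
rewrite exprS invfM => yx.
have yx3 : (3 * y - 3 * x <= 3 ^- m)%R by lra.
have m1 : (3 ^- m <= 1 :> R)%R by rewrite invf_le1 ?exprn_gt0 // exprn_ege1 // ler1n.
rewrite (Bernoulli_cdf_selfsimilar x) (Bernoulli_cdf_selfsimilar y).
have h1 : (F (3 * y) - F (3 * x) <= 2 ^- m)%R by apply: IHm; lra.
have h2 : (F (3 * y - 2) - F (3 * x - 2) <= 2 ^- m)%R by apply: IHm; lra.
rewrite exprS invfM.
have [x1|x1] := lerP 1%R (3 * x)%R.
  by rewrite (Bernoulli_cdf_ge1 x1) (@Bernoulli_cdf_ge1 (3 * y)%R) //; lra.
by rewrite (@Bernoulli_cdf_lt0 (3 * x - 2)%R) ?(@Bernoulli_cdf_lt0 (3 * y - 2)%R) //; lra.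
Qed.

Lemma Bernoulli_cdf_at0 : F 0 = 0%R.
Proof.
have := Bernoulli_cdf_selfsimilar 0; rewrite mulr0 sub0r (@Bernoulli_cdf_lt0 (-2)%R); lra.
Qed.

Lemma continuous_Bernoulli_cdf : continuous F.
Proof.
move=> x; apply/cvgrPdist_le => d d0.
have [m md] := exists_pow2_lt d0.
near=> y.
have : (`|x - y| <= 3 ^- m)%R.
  by near: y; apply: cvgr_dist_le => //; rewrite invr_gt0 exprn_gt0.
move=> xy; apply: (le_trans _ (ltW md)); have [h|h] := lerP x y.
  rewrite distrC ger0_norm ?subr_ge0 ?Bernoulli_cdf_nd //.
  by apply: Bernoulli_cdf_modulus => //; rewrite distrC ger0_norm ?subr_ge0 // in xy.
rewrite ger0_norm ?subr_ge0 ?Bernoulli_cdf_nd ?(ltW h) //.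
by apply: Bernoulli_cdf_modulus => //; rewrite ?ger0_norm ?subr_ge0 ?(ltW h) // in xy *; exact: ltW.
Unshelve. all: by end_near. Qed.

End cdf_of_Bernoulli.

(** * Integrals of powers against Lebesgue measure *)

Section powR_primitive.
Variable R : realType.
Implicit Types (b c e s u : R).

Let prim b u := (u `^ b / b)%R.

Let is_derive_prim b u : b != 0%R -> (0 < u)%R ->
  is_derive u (1%R : R) (prim b) (u `^ (b - 1))%R.
Proof.
move=> b0 u0.
have -> : (u `^ (b - 1) = b^-1 *: (b * u `^ (b - 1)) :> R)%R.
  by rewrite /GRing.scale /= mulrA mulVf // mul1r.
rewrite (_ : prim b = (b^-1 \*: (@powR R ^~ b))%R); last first.
  by apply/funext => v; rewrite /prim /= mulrC.
by apply: is_deriveZ; exact: is_derive1_powR.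
Qed.

Let continuous_powR b u : (0 < u)%R -> {for u, continuous (@powR R ^~ b)}.
Proof.
move=> u0; apply: differentiable_continuous; apply/derivable1_diffP.
by apply: derivable_powR; rewrite in_itv /= andbT.
Qed.

Lemma cvg_powRN s : (0 < s)%R -> (u `^ (- s))%R @[u --> +oo%R] --> (0 : R)%R.
Proof.
move=> s0; apply/cvgrPdist_le => d d0.
have h0 : (0 < d `^ (- s^-1))%R by rewrite powR_gt0.
near=> u.
have hu : (d `^ (- s^-1) <= u)%R by near: u; exact: nbhs_pinfty_ge.
rewrite sub0r normrN ger0_norm ?powR_ge0 // powRN.
have -> : d = ((d `^ (- s^-1)) `^ s)^-1%R.
  by rewrite -powRrM mulNr mulVf ?gt_eqF // powRN invrK powRr1 // ltW.
have u0 : (0 < u)%R by exact: lt_le_trans hu.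
rewrite lef_pV2 ?posrE ?powR_gt0 //.
by apply: ge0_ler_powR => //; rewrite ?nnegrE ltW.
Unshelve. all: by end_near. Qed.

Lemma integral_powR_infty s c : (0 < s)%R -> (0 < c)%R ->
  \int[lebesgue_measure]_(u in `[c, +oo[%classic) (u `^ (- s - 1))%:E =
  (c `^ (- s) / s)%:E.
Proof.
move=> s0 c0; have s0' : (- s != 0)%R by rewrite oppr_eq0 gt_eqF.
rewrite (@ge0_continuous_FTC2y _ _ (prim (- s)) c 0%R).
- by rewrite -EFinB sub0r /prim invrN mulrN opprK.
- by move=> *; exact: powR_ge0.
- apply: continuous_in_subspaceT => u /[!inE] /=; rewrite in_itv /= andbT => cu.
  by apply: continuous_powR; exact: lt_le_trans cu.
- rewrite /prim -[X in _ --> X](mul0r (- s)^-1%R); apply: cvgMr_tmp; exact: cvg_powRN.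
- move=> u cu; have u0 := lt_trans c0 cu.
  by have [] := is_derive_prim s0' u0.
- apply: cvg_at_right_filter; apply: cvgMr_tmp; exact: continuous_powR.
- move=> u; rewrite in_itv /= andbT => cu; have u0 := lt_trans c0 cu.
  by have [_] := is_derive_prim s0' u0; rewrite derive1E.
Qed.

(** The integrand may be unbounded at 0, so the fundamental theorem of calculus
    is applied away from 0 and the interval is exhausted. *)
Lemma integral_powR_0 s c : (0 < s)%R -> (0 < c)%R ->
  \int[lebesgue_measure]_(u in `]0%R, c]%classic) (u `^ (s - 1))%:E <=
  (c `^ s / s)%:E.
Proof.
move=> s0 c0; have s0' : (s != 0)%R by rewrite gt_eqF.
(* n.+2 keeps the left end point different from c *)
pose E (n : nat) : set R := `[(c / n.+2%:R)%R, c]%classic.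
have EU : \bigcup_n E n = `]0%R, c]%classic.
  apply/seteqP; split => [x [n _]|x]; rewrite /E /= !in_itv /= => /andP[x0 xc].
    rewrite xc andbT; apply: lt_le_trans x0; by rewrite divr_gt0.
  exists (Num.bound (c / x)%R) => //; rewrite /E /= in_itv /= xc andbT.
  rewrite ler_pdivrMr ?ltr0n // mulrC -ler_pdivrMr // ltW //.
  apply: lt_trans (archi_boundP _) _; first by rewrite divr_ge0 // ltW.
  by rewrite ltr_nat.
have mpow : measurable_fun (setT : set R) (fun u : R => (u `^ (s - 1))%:E).
  by apply/measurable_EFinP; exact: measurable_powR.
have ndE : {homo E : n m / (n <= m)%N >-> (n <= m)%O}.
  move=> n m nm; rewrite subsetEset; apply: subset_itvr; rewrite bnd_simp.
  by rewrite ler_pM2l // lef_pV2 ?posrE ?ltr0n // ler_nat.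
have cvgE : \int[lebesgue_measure]_(u in E n) (u `^ (s - 1))%:E @[n --> \oo] -->
    \int[lebesgue_measure]_(u in \bigcup_n E n) (u `^ (s - 1))%:E.
  apply: ge0_nondecreasing_set_cvg_integral => // [n|n|n x _].
  - exact: measurable_itv.
  - exact: measurable_funTS.
  - by rewrite lee_fin powR_ge0.
rewrite -EU -(cvg_lim _ cvgE) //; apply: lime_le; first exact: (cvgP _ cvgE).
near=> n.
have n0 : (0 < c / n.+2%:R)%R by rewrite divr_gt0.
have nc : (c / n.+2%:R < c)%R by rewrite ltr_pdivrMr // ltr_pMr // ltr1n.
have pos u : (c / n.+2%:R <= u)%R -> (0 < u)%R by exact: lt_le_trans.
rewrite /E (@continuous_FTC2 _ _ (prim s)) //.
- by rewrite -EFinB lee_fin /prim gerBl divr_ge0 ?powR_ge0 // ltW.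
- apply: continuous_in_subspaceT => u /[!inE] /=; rewrite in_itv /= => /andP[/pos u0 _].
  exact: continuous_powR.
- split.
  + by move=> u; rewrite in_itv /= => /andP[/ltW/pos u0 _]; have [] := is_derive_prim s0' u0.
  + by apply: cvg_at_right_filter; apply: cvgMr_tmp; exact: continuous_powR.
  + by apply: cvg_at_left_filter; apply: cvgMr_tmp; exact: continuous_powR.
- move=> u; rewrite in_itv /= => /andP[/ltW/pos u0 _].
  by have [_] := is_derive_prim s0' u0; rewrite derive1E.
Unshelve. all: by end_near. Qed.

End powR_primitive.

(** * Transfer to Lebesgue measure by a continuous distribution function *)

Section distribution_function_transfer.
Variables (R : realType) (lam : {measure set (measurableTypeR R) -> \bar R}).
Variable G : R -> R.
Hypothesis lamG : forall x : R, lam `]-oo, x]%classic = (G x)%:E.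
Hypothesis cG : continuous G.
Hypothesis G0 : exists x, G x = 0%R.
Hypothesis Gy : forall s : R, exists x, (s <= G x)%R.

Lemma distribution_function_nd : {homo G : x y / (x <= y)%R}.
Proof.
move=> x y xy; rewrite -lee_fin -!lamG le_measure ?inE //.
by apply: subset_itvl; rewrite bnd_simp.
Qed.

Lemma distribution_function_ge0 x : (0 <= G x)%R.
Proof. by rewrite -lee_fin -lamG. Qed.

Lemma measurable_distribution_function :
  measurable_fun setT (G : measurableTypeR R -> measurableTypeR R).
Proof.
by apply: nondecreasing_measurable => // x y; exact: distribution_function_nd.
Qed.

Lemma distribution_function_surj (s : R) : (0 <= s)%R -> exists x, G x = s.
Proof.
move=> s0; have [a Ga] := G0; have [b sb] := Gy s.
have [ab|ba] := lerP a b; last first.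
  exists b; apply/eqP; rewrite eq_le sb andbT (le_trans _ s0) // -Ga.
  by rewrite distribution_function_nd // ltW.
have [] := @IVT R G a b s ab; first exact: continuous_subspaceT.
  by rewrite Ga min_l ?max_r ?s0 ?sb // (le_trans s0).
by move=> x _ Gx; exists x.
Qed.

Let mS t : measurable (G @^-1` `]-oo, t]%classic : set (measurableTypeR R)).
Proof.
by rewrite -[X in measurable X]setTI; exact: measurable_distribution_function.
Qed.

(** The sublevel set {G <= s} may exceed the ray ]-oo, y], where G y = s, by a
    plateau of G. It is contained in every ray whose right end point has value
    s + e, so the plateau has no mass. *)
Lemma measure_sublevel (s : R) : (0 <= s)%R -> lam (G @^-1` `]-oo, s]%classic) = s%:E.
Proof.
move=> s0; apply/eqP; rewrite eq_le; apply/andP; split.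
  apply/lee_addgt0Pr => e e0.
  have [y Gye] : exists y, G y = (s + e)%R by apply: distribution_function_surj; lra.
  rewrite -EFinD -Gye -lamG le_measure ?inE // => x /=; rewrite !in_itv /= => Gx.
  rewrite leNgt; apply/negP => /ltW/distribution_function_nd; lra.
have [y Gys] := distribution_function_surj s0.
rewrite -[X in X%:E <= _]Gys -lamG le_measure ?inE // => x /=; rewrite !in_itv /= -Gys.
exact: distribution_function_nd.
Qed.

(** The image measure is carried by [0, +oo[. Adding Lebesgue measure on
    ]-oo, 0] to it gives a measure on the whole line, which can be compared with
    Lebesgue measure on the intervals ]a, b]. *)
Lemma pushforward_distribution_function (D : set (measurableTypeR R)) :
    measurable D -> D `<=` `]0%R, +oo[%classic ->
  pushforward lam (G : measurableTypeR R -> measurableTypeR R) D = lebesgue_measure D.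
Proof.
move=> mD D0.
pose mN : measurable (`]-oo, 0%R]%classic : set (measurableTypeR R)) := measurable_itv _.
pose nu : {measure set (measurableTypeR R) -> \bar R} :=
  measure_function_pushforward__canonical__measure_function_Measure lam
    measurable_distribution_function.
pose nu' : {measure set (measurableTypeR R) -> \bar R} :=
  measure_add nu (mrestr lebesgue_measure mN).
have nu'E A : nu' A = lam (G @^-1` A) + lebesgue_measure (A `&` `]-oo, 0%R]%classic).
  exact: measure_addE.
transitivity (nu' D); last first.
  apply/esym; apply: lebesgue_measure_unique => //= _ [[a b] _ <-] /=.
  rewrite nu'E; have [ab|ba] := ltrP a b; last first.
    by rewrite set_itv_ge ?bnd_simp -?leNgt // preimage_set0 set0I !measure0 adde0.
  have [a0|a0] := lerP 0%R a.
    rewrite (_ : _ `&` _ = set0) ?measure0 ?adde0; last first.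
      by rewrite -subset0 => x []; rewrite /= !in_itv /=; lra.
    have -> : G @^-1` `]a, b]%classic = G @^-1` `]-oo, b]%classic `\` G @^-1` `]-oo, a]%classic.
      apply/seteqP; split => x /=; rewrite !in_itv /=.
        by case/andP => ax xb; split => //; apply/negP; rewrite -ltNge.
      by case=> xb /negP; rewrite -ltNge => ->.
    have b0 : (0 <= b)%R := le_trans a0 (ltW ab).
    have -> : lam (G @^-1` `]-oo, b]%classic `\` G @^-1` `]-oo, a]%classic) = b%:E - a%:E.
      rewrite -(measure_sublevel b0) -(measure_sublevel a0).
      rewrite -[X in _ - lam X](@setIidr _ (G @^-1` `]-oo, b]%classic)).
        by apply: measureD => //; rewrite [ltLHS]measure_sublevel ?ltry.
      by move=> x /=; rewrite !in_itv /=; lra.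
    by rewrite lebesgue_measure_itv /= lte_fin ab.
  have [b0|b0] := lerP b 0%R.
    have -> : lam (G @^-1` `]a, b]%classic) = 0.
      apply: (subset_measure0 _ (mS 0%R) _ (measure_sublevel (lexx 0%R))).
        rewrite -[X in measurable X]setTI; exact: measurable_distribution_function.
      by move=> x /=; rewrite !in_itv /=; lra.
    by rewrite add0e setIidl // => x /=; rewrite !in_itv /=; lra.
  have -> : G @^-1` `]a, b]%classic = G @^-1` `]-oo, b]%classic.
    by apply/seteqP; split => x /=; rewrite !in_itv /=; have := distribution_function_ge0 x; lra.
  have -> : `]a, b]%classic `&` `]-oo, 0%R]%classic = `]a, 0%R]%classic.
    by apply/seteqP; split => [x []|x] /=; rewrite !in_itv /=; lra.
  rewrite measure_sublevel; last by lra.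
  by rewrite !lebesgue_measure_itv /= !lte_fin ab a0 -!EFinD; congr EFin; lra.
rewrite nu'E /pushforward (_ : D `&` _ = set0) ?measure0 ?adde0 //.
by rewrite -subset0 => x [/D0 /=]; rewrite !in_itv /= andbT => x0; rewrite leNgt x0.
Qed.

(** The change of variables u = G x. *)
Lemma ge0_integral_distribution_function (D : set (measurableTypeR R)) (h : R -> \bar R) :
  measurable D -> D `<=` `]0%R, +oo[%classic -> measurable_fun D h ->
  (forall u, D u -> 0 <= h u) ->
  \int[lam]_(x in G @^-1` D) h (G x) = \int[lebesgue_measure]_(u in D) h u.
Proof.
move=> mD D0 mh h0.
rewrite -(ge0_integral_pushforward measurable_distribution_function) //; last first.
  by move=> y /[!inE]; exact: h0.
apply: eq_measure_integral => [|mG A mA AD].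
  exact: measurable_distribution_function.
exact: (pushforward_distribution_function mA (subset_trans AD D0)).
Qed.

End distribution_function_transfer.

(** * Tonelli on a triangle and Hoelder on a set *)

(** Tonelli's theorem for the kernel a x * b t on the triangle 0 < t <= x. It
    also yields the measurability of the partial integrals, without which they
    could not be compared under a further integral. *)
Lemma tonelli_triangle (R : realType)
    (lam : {sigma_finite_measure set (measurableTypeR R) -> \bar R}) (a b : R -> R) :
  measurable_fun (setT : set (measurableTypeR R)) (a : _ -> measurableTypeR R) ->
  measurable_fun (setT : set (measurableTypeR R)) (b : _ -> measurableTypeR R) ->
  (forall x, 0 <= a x)%R -> (forall x, 0 <= b x)%R ->
  measurable_fun (setT : set (measurableTypeR R))
    (fun x => \int[lam]_(t in `]0%R, x]%classic) (b t)%:E) /\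
  measurable_fun (`]0%R, +oo[%classic : set (measurableTypeR R))
    (fun t => (b t)%:E * \int[lam]_(x in `[t, +oo[%classic) (a x)%:E) /\
  \int[lam]_(x in `]0%R, +oo[%classic)
     ((a x)%:E * \int[lam]_(t in `]0%R, x]%classic) (b t)%:E) =
  \int[lam]_(t in `]0%R, +oo[%classic)
     ((b t)%:E * \int[lam]_(x in `[t, +oo[%classic) (a x)%:E).
Proof.
move=> ma mb a0 b0.
pose T : set (measurableTypeR R * measurableTypeR R) :=
  [set z | (0 < z.2)%R /\ (z.2 <= z.1)%R].
have mT : measurable T.
  have -> : T = ((fun z => z.2) @^-1` `]0%R, +oo[%classic) `&`
      ((fun z => (z.2 : R) - z.1)%R @^-1` `]-oo, 0%R]%classic).
    by apply/seteqP; split => -[x t]; rewrite /T /= !in_itv /= andbT subr_le0.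
  apply: measurableI; rewrite -[X in measurable X]setTI.
    exact: measurable_snd.
  exact: measurable_funB.
have m1T : measurable_fun setT (fun z => (\1_T z : R)) by exact: measurable_indic.
pose K (c : R -> R) z : \bar R := (c z.1 * (b z.2 * \1_T z))%:E.
have mK c : measurable_fun (setT : set (measurableTypeR R)) (c : _ -> measurableTypeR R) ->
    measurable_fun setT (K c).
  move=> mc; apply/measurable_EFinP; apply: measurable_funM.
    exact: measurableT_comp mc measurable_fst.
  apply: measurable_funM => //; exact: measurableT_comp mb measurable_snd.
have K0 c z : (forall x, 0 <= c x)%R -> 0 <= K c z.
  by move=> c0; rewrite lee_fin !mulr_ge0.
have KF c x : (0 <= c x)%R ->
   \int[lam]_t K c (x, t) = (c x)%:E * \int[lam]_(t in `]0%R, x]%classic) (b t)%:E.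
  move=> c0; rewrite [in RHS]integral_mkcond -ge0_integralZl_EFin //.
  - apply: eq_integral => t _; rewrite /K /= patchE indicE mem_setE in_itv /=.
    case: ifPn => tx.
      by rewrite mem_set ?mulr1 //; apply/andP.
    by rewrite memNset ?mulr0 ?mule0 // => /andP; exact/negP.
  - by move=> t _; apply: erestrict_ge0 => {}t _; rewrite lee_fin.
  - by apply/(measurable_restrictT _ (measurable_itv _)); apply/measurable_EFinP/measurable_funTS.
have KG t : (0 < t)%R ->
   \int[lam]_x K a (x, t) = (b t)%:E * \int[lam]_(x in `[t, +oo[%classic) (a x)%:E.
  move=> t0; rewrite [in RHS]integral_mkcond -ge0_integralZl_EFin //; last 2 first.
  - by move=> x _; apply: erestrict_ge0 => {}x _; rewrite lee_fin.
  - by apply/(measurable_restrictT _ (measurable_itv _)); apply/measurable_EFinP/measurable_funTS.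
  apply: eq_integral => x _; rewrite /K /= patchE indicE mem_setE in_itv /= andbT.
  case: ifPn => tx.
    by rewrite mem_set ?mulr1 // mulrC.
  by rewrite memNset ?mulr0 ?mule0 // => -[_]; exact/negP.
split.
  rewrite (_ : (fun x => _) = fubini_F lam (K (cst 1%R))); last first.
    by apply/funext => x; rewrite /fubini_F KF // mul1e.
  apply: measurable_fun_fubini_tonelli_F; first exact: mK.
  by move=> z; apply: K0 => x; exact: ler01.
split.
  apply: (@eq_measurable_fun _ _ _ _ _ (fubini_G lam (K a))).
    by move=> t; rewrite inE /= in_itv /= andbT => t0; rewrite /fubini_G KG.
  apply: measurable_funTS; apply: measurable_fun_fubini_tonelli_G; first exact: mK.
  by move=> z; exact: K0.
transitivity (\int[lam]_x \int[lam]_t K a (x, t)).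
  rewrite integral_mkcond; apply: eq_integral => x _; rewrite KF // patchE mem_setE in_itv /= andbT.
  case: ifPn => //; rewrite -leNgt => x0.
  by rewrite set_itv_ge ?bnd_simp -?leNgt // integral_set0 mule0.
transitivity (\int[lam]_t \int[lam]_x K a (x, t)).
  by apply: fubini_tonelli => [|z]; [exact: mK|exact: K0].
rewrite [RHS]integral_mkcond; apply: eq_integral => t _.
rewrite patchE mem_setE in_itv /= andbT; case: ifPn => [t0|]; first by rewrite KG.
rewrite -leNgt => t0; rewrite integral0_eq // => x _.
by rewrite /K indicE memNset ?mulr0 // /T /= ltNge t0 => -[].
Qed.

Lemma ge0_le_poweR (R : realType) (a b : \bar R) (r : R) :
  (0 <= r)%R -> 0 <= a -> a <= b -> a `^ r <= b `^ r.
Proof.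
move=> r0 a0 ab; apply: gt0_ler_poweR => //; rewrite in_itv /= leey andbT //.
exact: le_trans ab.
Qed.

(** Hoelder's inequality for the two functions cut off outside A. *)
Lemma ge0_hoelder_on d (T : measurableType d) (R : realType)
    (nu : {measure set T -> \bar R}) (A : set T) (f g : T -> R) (p q : R) :
  measurable A -> measurable_fun setT f -> measurable_fun setT g ->
  (forall x, 0 <= f x)%R -> (forall x, 0 <= g x)%R ->
  (0 < p)%R -> (0 < q)%R -> (p^-1 + q^-1 = 1)%R ->
  \int[nu]_(x in A) (f x * g x)%:E <=
  (\int[nu]_(x in A) (f x `^ p)%:E) `^ p^-1 *
  (\int[nu]_(x in A) (g x `^ q)%:E) `^ q^-1.
Proof.
move=> mA mf mg f0 g0 p0 q0 pq.
have mI : measurable_fun setT (\1_A : T -> R) by exact: measurable_indic.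
have E (h : T -> R) (r : R) : (forall x, 0 <= h x)%R -> (0 < r)%R ->
    Lnorm nu r%:E (EFin \o (h \* \1_A)%R) = (\int[nu]_(x in A) (h x `^ r)%:E) `^ r^-1.
  move=> h0 r0; rewrite unlock /Lnorm; apply: (congr1 (fun z => z `^ r^-1)).
  rewrite [RHS]integral_mkcond; apply: eq_integral => x _.
  rewrite patchE /= indicE; case: ifPn => _; rewrite ?mulr1 ?mulr0 /=.
    by rewrite ger0_norm.
  by rewrite normr0 powR0 ?gt_eqF.
rewrite -(E f p f0 p0) -(E g q g0 q0); apply: le_trans (hoelder _ _ _ p0 q0 pq).
- rewrite Lnorm1 integral_mkcond le_eqVlt; apply/orP; left; apply/eqP.
  apply: eq_integral => x _.
  rewrite patchE /= indicE; case: ifPn => _; rewrite ?mulr1 ?mulr0 /= ?normr0 //.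
  by rewrite ger0_norm // mulr_ge0.
- exact: measurable_funM mf mI.
- exact: measurable_funM mg mI.
Qed.

(** * The sharp Hardy inequality for an atomless measure *)

(** The hypotheses on G say that lam is carried by [0, +oo[, has no atoms, has
    infinite total mass and charges every ]0, x]. *)
Section weighted_hardy.
Variables (R : realType) (lam : {sigma_finite_measure set (measurableTypeR R) -> \bar R}).
Variable G : R -> R.
Hypothesis lamG : forall x : R, lam `]-oo, x]%classic = (G x)%:E.
Hypothesis cG : continuous G.
Hypothesis G0 : G 0 = 0%R.
Hypothesis Gy : forall s : R, exists x, (s <= G x)%R.
Hypothesis G_gt0 : forall x : R, (0 < x)%R -> (0 < G x)%R.

Local Notation D := (`]0%R, +oo[%classic : set (measurableTypeR R)).

Let Gnd := distribution_function_nd lamG.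
Let mG := measurable_distribution_function lamG.
Let Gex0 : exists x, G x = 0%R. Proof. by exists 0%R. Qed.

Let mpowG r : measurable_fun setT (fun x => G x `^ r)%R.
Proof. exact: (measurableT_comp (measurable_powR _) mG). Qed.

(** Kept in the context for the side conditions of the two moment bounds. *)
Let measurable_Gpre (i : interval R) : measurable (G @^-1` [set` i] : set (measurableTypeR R)).
Proof. by rewrite -[X in measurable X]setTI; exact: mG. Qed.

(** The interval ]0, x] lies in {0 < G <= G x}, over which the change of
    variables u = G t gives the integral of u^(s-1) over ]0, G x]. *)
Lemma integral_head_moment s x : (0 < s)%R -> (0 < x)%R ->
  \int[lam]_(t in `]0%R, x]%classic) (G t `^ (s - 1))%:E <= (G x `^ s / s)%:E.
Proof.
move=> s0 x0; apply: le_trans (integral_powR_0 s0 (G_gt0 x0)).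
rewrite -(ge0_integral_distribution_function lamG cG Gex0 Gy
  (h := fun u => (u `^ (s - 1))%:E)) //.
- apply: ge0_subset_integral => //=.
  + by apply/measurable_EFinP; apply: measurable_funTS; exact: mpowG.
  + by move=> t _; rewrite lee_fin powR_ge0.
  + by move=> t /=; rewrite !in_itv /= => /andP[/G_gt0 -> /Gnd].
- by apply: subset_itvl.
- by apply/measurable_EFinP; apply: measurable_funTS; exact: measurable_powR.
- by move=> t _; rewrite lee_fin powR_ge0.
Qed.

(** Likewise [x, +oo[ lies in {G >= G x}. *)
Lemma integral_tail_moment s x : (0 < s)%R -> (0 < x)%R ->
  \int[lam]_(t in `[x, +oo[%classic) (G t `^ (- s - 1))%:E <= (G x `^ (- s) / s)%:E.
Proof.
move=> s0 x0; rewrite -(integral_powR_infty s0 (G_gt0 x0)).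
rewrite -(ge0_integral_distribution_function lamG cG Gex0 Gy
  (h := fun u => (u `^ (- s - 1))%:E)) //.
- apply: ge0_subset_integral => //=.
  + by apply/measurable_EFinP; apply: measurable_funTS; exact: mpowG.
  + by move=> t _; rewrite lee_fin powR_ge0.
  + by move=> t /=; rewrite !in_itv /= !andbT => /Gnd.
- by move=> t /=; rewrite !in_itv /= !andbT; apply: lt_le_trans; exact: G_gt0.
- by apply/measurable_EFinP; apply: measurable_funTS; exact: measurable_powR.
- by move=> t _; rewrite lee_fin powR_ge0.
Qed.

(** Hoelder's inequality with the conjugate exponents p and 1/s, applied to
    f = (f G^(s/p)) G^(-s/p). The power of G is the one that keeps the constant
    sharp: the head moment of exponent s here, and later the tail moment of
    exponent -s, each contribute powers of 1/s, in total s^-p. *)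
Lemma hoelder_average (f : R -> R) p s x : (1 < p)%R -> s = ((p - 1) / p)%R -> (0 < x)%R ->
  measurable_fun (setT : set (measurableTypeR R)) (f : _ -> measurableTypeR R) ->
  (forall t, 0 <= f t)%R ->
  ((G x)^-1%:E * \int[lam]_(t in `]0%R, x]%classic) (f t)%:E) `^ p <=
  (s `^ (1 - p))%:E * ((G x `^ (- s - 1))%:E *
    \int[lam]_(t in `]0%R, x]%classic) (f t `^ p * G t `^ s)%:E).
Proof.
move=> p1 sE x0 mf f0.
have p0 : (0 < p)%R by exact: lt_trans p1.
have pN0 : p != 0%R by rewrite gt_eqF.
have s0 : (0 < s)%R by rewrite sE divr_gt0 // subr_gt0.
have sN0 : s != 0%R by rewrite gt_eqF.
have Gx0 := G_gt0 x0.
have -> : \int[lam]_(t in `]0%R, x]%classic) (f t)%:E =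
    \int[lam]_(t in `]0%R, x]%classic) (f t * G t `^ (s / p) * G t `^ (- (s / p)))%:E.
  apply: eq_integral => t; rewrite inE /= in_itv /= => /andP[t0 _].
  by rewrite powRN mulfK // gt_eqF // powR_gt0 // G_gt0.
have mfG : measurable_fun setT (fun t => f t * G t `^ (s / p))%R by exact: measurable_funM.
have H := @ge0_hoelder_on _ _ R lam `]0%R, x]%classic _ _ p s^-1 (measurable_itv _) mfG
  (mpowG (- (s / p))) (fun t => mulr_ge0 (f0 t) (powR_ge0 _ _)) (fun t => powR_ge0 _ _) p0.
have {H} := H _ _; rewrite invr_gt0 s0 invrK => /(_ isT).
have -> : (p^-1 + s = 1)%R by rewrite sE; field.
move=> /(_ erefl).
have -> : \int[lam]_(t in `]0%R, x]%classic) ((f t * G t `^ (s / p)) `^ p)%:E =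
   \int[lam]_(t in `]0%R, x]%classic) (f t `^ p * G t `^ s)%:E.
  apply: eq_integral => t _.
  by rewrite powRM ?powR_ge0 // -powRrM divfK.
have -> : \int[lam]_(t in `]0%R, x]%classic) ((G t `^ (- (s / p))) `^ s^-1)%:E =
   \int[lam]_(t in `]0%R, x]%classic) (G t `^ (s - 1))%:E.
  apply: eq_integral => t _.
  rewrite -powRrM; congr (G t `^ _)%:E; rewrite sE; field.
  by rewrite pN0 /= subr_eq0 gt_eqF.
set H := \int[lam]_(t in _) (f t `^ p * G t `^ s)%:E => hle.
have HE0 : 0 <= H by apply: integral_ge0 => t _; rewrite lee_fin mulr_ge0 ?powR_ge0.
set I := \int[lam]_(t in _) (f t * _ * _)%:E in hle *.
have I0 : 0 <= I by apply: integral_ge0 => t _; rewrite lee_fin !mulr_ge0 ?powR_ge0.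
have {}hle : I <= H `^ p^-1 * (G x `^ s / s)%:E `^ s.
  apply: le_trans hle _; apply: lee_pmul => //; first exact: poweR_ge0.
  - exact: poweR_ge0.
  - apply: ge0_le_poweR; [exact: ltW| |exact: integral_head_moment].
    by apply: integral_ge0 => t _; rewrite lee_fin powR_ge0.
have Gi0 : (0 <= (G x)^-1)%R by rewrite invr_ge0 ltW.
rewrite poweRM ?lee_fin //.
apply: (@le_trans _ _ ((G x)^-1%:E `^ p * (H `^ p^-1 * (G x `^ s / s)%:E `^ s) `^ p)).
  apply: lee_pmul => //; [exact: poweR_ge0|exact: poweR_ge0|].
  by apply: ge0_le_poweR hle; first exact: ltW.
have sp : (s * p = p - 1)%R by rewrite sE divfK.
have -> : (H `^ p^-1 * (G x `^ s / s)%:E `^ s) `^ p = H * ((G x `^ s / s) `^ (p - 1))%:E.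
  rewrite poweRM; [|exact: poweR_ge0..].
  by rewrite -!poweRrM mulVf // poweRe1 // sp.
have c : ((G x)^-1 `^ p * (G x `^ s / s) `^ (p - 1) = s `^ (1 - p) * G x `^ (- s - 1))%R.
  have inv (y : R) r : (0 < y)%R -> (y^-1 `^ r = y `^ (- r))%R.
    by move=> y0; rewrite -powR_inv1 ?ltW // -powRrM mulN1r.
  rewrite powRM ?powR_ge0 ?invr_ge0 ?(ltW s0) // !inv // -powRrM mulrA -powRD; last first.
    by rewrite (gt_eqF Gx0) implybT.
  by rewrite mulrC opprB mulrBr mulr1 sp; congr (_ * G x `^ _)%R; ring.
by rewrite [H * _]muleC muleA poweR_EFin -EFinM c EFinM -muleA.
Qed.

(** After Tonelli's theorem the inner integral is a tail moment, which
    cancels the weight G^s and leaves the factor s^(1-p) * s^-1 = s^-p. *)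
Lemma hardy_positive_real (f : R -> R) p : (1 < p)%R ->
  measurable_fun (setT : set (measurableTypeR R)) (f : _ -> measurableTypeR R) ->
  (forall t, 0 <= f t)%R ->
  \int[lam]_(x in D) (((G x)^-1%:E * \int[lam]_(t in `]0%R, x]%classic) (f t)%:E) `^ p) <=
  ((p / (p - 1)) `^ p)%:E * \int[lam]_(x in D) (f x `^ p)%:E.
Proof.
move=> p1 mf f0.
pose s := ((p - 1) / p)%R.
have p0 : (0 < p)%R by exact: lt_trans p1.
have s0 : (0 < s)%R by rewrite divr_gt0 // subr_gt0.
have mfp : measurable_fun setT (fun t => f t `^ p)%R.
  exact: (measurableT_comp (measurable_powR _) mf).
have mfpG : measurable_fun setT (fun t => f t `^ p * G t `^ s)%R by exact: measurable_funM.
have [mI _] := tonelli_triangle lam (mpowG (- s - 1)) mf (fun=> powR_ge0 _ _) f0.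
have fG0 t : (0 <= f t `^ p * G t `^ s)%R by rewrite mulr_ge0 ?powR_ge0.
have [mH [mT tonelli]] := tonelli_triangle lam (mpowG (- s - 1)) mfpG (fun=> powR_ge0 _ _) fG0.
have mGH : measurable_fun D (fun x => (G x `^ (- s - 1))%:E *
    \int[lam]_(t in `]0%R, x]%classic) (f t `^ p * G t `^ s)%:E).
  apply: measurable_funTS; apply: emeasurable_funM => //.
  by apply/measurable_EFinP; exact: mpowG.
have GH0 x : 0 <= (G x `^ (- s - 1))%:E *
    \int[lam]_(t in `]0%R, x]%classic) (f t `^ p * G t `^ s)%:E.
  by rewrite mule_ge0 ?lee_fin ?powR_ge0 // integral_ge0 // => t _; rewrite lee_fin.
apply: (@le_trans _ _ (\int[lam]_(x in D) ((s `^ (1 - p))%:E * ((G x `^ (- s - 1))%:E *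
    \int[lam]_(t in `]0%R, x]%classic) (f t `^ p * G t `^ s)%:E)))).
  apply: ge0_le_integral; [exact: measurable_itv|..].
  - by move=> x _; exact: poweR_ge0.
  - apply: (measurableT_comp (measurable_poweR _)); apply: measurable_funTS.
    apply: emeasurable_funM => //; apply/measurable_EFinP.
    rewrite (_ : (fun x => (G x)^-1)%R = (fun x => G x `^ (-1))%R); first exact: mpowG.
    by apply/funext => x; rewrite powR_inv1 // (distribution_function_ge0 lamG).
  - exact: measurable_funeM.
  - by move=> x; rewrite /= in_itv /= andbT => x0; exact: hoelder_average.
rewrite ge0_integralZl_EFin ?powR_ge0 //.
rewrite tonelli.
apply: (@le_trans _ _ ((s `^ (1 - p))%:E * \int[lam]_(t in D) (s^-1%:E * (f t `^ p)%:E))).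
  apply: lee_wpmul2l; first by rewrite lee_fin powR_ge0.
  apply: ge0_le_integral; [exact: measurable_itv|..].
  - move=> t _; rewrite mule_ge0 ?lee_fin // integral_ge0 // => x _.
    by rewrite lee_fin powR_ge0.
  - exact: mT.
  - by apply/measurable_EFinP; apply: measurable_funTS; exact: measurable_funM.
  move=> t; rewrite /= in_itv /= andbT => t0.
  apply: (@le_trans _ _ ((f t `^ p * G t `^ s)%:E * (G t `^ (- s) / s)%:E)).
    by apply: lee_wpmul2l; rewrite ?lee_fin // integral_tail_moment.
  rewrite -!EFinM lee_fin mulrA powRN -[X in (X / s)%R]mulrA divff ?mulr1 1?mulrC //.
  by rewrite gt_eqF // powR_gt0 // G_gt0.
rewrite ge0_integralZl_EFin ?invr_ge0 ?(ltW s0) //; last 2 first.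
- by move=> t _; rewrite lee_fin powR_ge0.
- by apply/measurable_EFinP; exact: measurable_funTS.
rewrite muleA -EFinM le_eqVlt; apply/orP; left; apply/eqP; congr (_%:E * _).
have -> : (p / (p - 1) = s^-1)%R by rewrite /s invf_div.
rewrite -powR_inv1 ?ltW // -powRrM -powRD; last by rewrite (gt_eqF s0) implybT.
by congr (_ `^ _)%R; ring.
Qed.

(** When the right-hand side is finite, f is finite almost everywhere and can be
    replaced by a real-valued function. *)
Lemma hardy_positive (f : R -> \bar R) p : (1 < p)%R ->
  measurable_fun D f -> (forall x, D x -> 0 <= f x) ->
  \int[lam]_(x in D) (((G x)^-1%:E * \int[lam]_(t in `]0%R, x]%classic) f t) `^ p) <=
  ((p / (p - 1)) `^ p)%:E * \int[lam]_(x in D) (f x `^ p).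
Proof.
move=> p1 mf f0.
have p0 : (0 < p)%R by exact: lt_trans p1.
have mD : measurable D by exact: measurable_itv.
have mfp : measurable_fun D (fun x => f x `^ p).
  exact: (measurableT_comp (measurable_poweR _) mf).
have c0 : (0 < (p / (p - 1)) `^ p)%R by rewrite powR_gt0 // divr_gt0 // subr_gt0.
have [->|Ioo] := eqVneq (\int[lam]_(x in D) (f x `^ p)) +oo.
  by rewrite gt0_muley ?lte_fin // leey.
have Ifp : lam.-integrable D (fun x => f x `^ p).
  apply/integrableP; split => //.
  under eq_integral do rewrite gee0_abs ?poweR_ge0 //.
  by rewrite ltey.
pose g (x : R) : R := fine ((f \_ D) x).
have g0 x : (0 <= g x)%R by apply: fine_ge0; exact: erestrict_ge0.
have mg : measurable_fun (setT : set (measurableTypeR R)) (g : _ -> measurableTypeR R).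
  by apply: (measurableT_comp (fine_measurable measurableT)); apply/(measurable_restrictT _ mD).
have fg : ae_eq lam D f (EFin \o g).
  have := integrable_ae mD Ifp; apply: filterS => x /[swap] Dx /(_ Dx) fin.
  rewrite /g /= patchE mem_set // fineK //.
  have := f0 x Dx; move: fin; case: (f x) => //=; by rewrite gt_eqF.
have mEg A : measurable_fun A (EFin \o g : measurableTypeR R -> \bar R).
  by apply/measurable_EFinP; apply: measurable_funTS.
rewrite (_ : \int[lam]_(x in D) (f x `^ p) = \int[lam]_(x in D) (g x `^ p)%:E); last first.
  apply: ge0_ae_eq_integral => //.
  - apply/measurable_EFinP; apply: measurable_funTS.
    exact: (measurableT_comp (measurable_powR _) mg).
  - by move=> x _; exact: poweR_ge0.
  - by move=> x _; rewrite lee_fin powR_ge0.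
  - by apply: filterS fg => x /[swap] Dx /(_ Dx) ->.
apply: le_trans (hardy_positive_real p1 mg g0); rewrite le_eqVlt; apply/orP; left; apply/eqP.
apply: eq_integral => x _; congr ((_ * _) `^ _).
have sD : `]0%R, x]%classic `<=` D by exact: subset_itvl.
apply: ge0_ae_eq_integral => //.
- exact: measurable_funS mf.
- by move=> t /sD; exact: f0.
- by move=> t _; rewrite lee_fin.
- by apply: filterS fg => t + /sD; apply.
Qed.

Lemma measure_ray0 (x : R) : (x <= 0)%R -> lam `]-oo, x]%classic = 0.
Proof.
move=> x0; rewrite lamG; congr (_%:E); apply/eqP.
by rewrite eq_le (distribution_function_ge0 lamG) -G0 Gnd.
Qed.

Lemma measure_origin : lam [set 0%R] = 0.
Proof.
apply: (subset_measure0 _ _ _ (measure_ray0 (lexx 0%R))) => // x -> /=.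
by rewrite in_itv /=.
Qed.

Lemma measure_upto (x : R) : (0 <= x)%R -> lam `[0%R, x]%classic = (G x)%:E.
Proof.
move=> x0; rewrite -lamG; apply/eqP; rewrite eq_le; apply/andP; split.
  by rewrite le_measure ?inE //; exact: subset_itvr.
rewrite (_ : `]-oo, x]%classic = `]-oo, 0%R]%classic `|` `[0%R, x]%classic); last first.
  apply/seteqP; split => [t|t []] /=; rewrite !in_itv /=; [|lra|lra].
  by case: (lerP t 0%R) => [|/ltW -> ->]; auto.
apply: le_trans (measureU2 _ _ _) _ => //.
by rewrite [X in X + _](measure_ray0 (lexx 0%R)) add0e.
Qed.

Lemma measure_upto_open (x : R) : (0 <= x)%R -> lam `]0%R, x]%classic = (G x)%:E.
Proof.
move=> x0; rewrite -measure_upto // -(@setU1itv _ _ _ _ false) ?bnd_simp //.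
apply/eqP; rewrite eq_le; apply/andP; split.
  by rewrite le_measure ?inE //; exact: measurableU.
apply: le_trans (measureU2 _ _ _) _ => //.
by rewrite [X in X + _]measure_origin add0e.
Qed.

Lemma integral_upto (f : R -> \bar R) (x : R) : (0 <= x)%R ->
  measurable_fun (`[0%R, +oo[%classic : set (measurableTypeR R)) f ->
  (forall x : R, (0 <= x)%R -> 0 <= f x) ->
  \int[lam]_(t in `[0%R, x]%classic) f t = \int[lam]_(t in `]0%R, x]%classic) f t.
Proof.
move=> x0 mf f0; rewrite (@ge0_negligible_integral _ _ _ lam _ [set (0%R : measurableTypeR R)]) //.
- congr integral; apply/seteqP; split => t /=; rewrite !in_itv /=.
    by case=> /andP[t0 ->] /eqP; rewrite lt_neqAle t0 eq_sym => ->.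
  by move=> /andP[t0 ->]; split; [rewrite ltW|apply/eqP; rewrite gt_eqF].
- by apply: measurable_funS mf => //; exact: subset_itvl.
- by move=> t /=; rewrite in_itv /= => /andP[/f0].
- exact: measure_origin.
Qed.

(** The point 0 is negligible for lam; there, the left integrand is the p-th
    power of the product of +oo and 0, hence 0. *)
Lemma hardy_halfline (f : R -> \bar R) p : (1 < p)%R ->
  measurable_fun (`[0%R, +oo[%classic : set (measurableTypeR R)) f ->
  (forall x : R, (0 <= x)%R -> 0 <= f x) ->
  \int[lam]_(x in `[0%R, +oo[%classic)
    ((lam `[0%R, x]%classic)^-1 * \int[lam]_(t in `[0%R, x]%classic) f t) `^ p <=
  ((p / (p - 1)) `^ p)%:E * \int[lam]_(x in `[0%R, +oo[%classic) (f x `^ p).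
Proof.
move=> p1 mf f0; have p0 : (0 < p)%R by exact: lt_trans p1.
have DH : D `<=` `[0%R, +oo[%classic by apply: subset_itvr; rewrite bnd_simp.
have f0D x : D x -> 0 <= f x by rewrite /= in_itv /= andbT => /ltW/f0.
apply: (@le_trans _ _ (((p / (p - 1)) `^ p)%:E * \int[lam]_(x in D) (f x `^ p))); last first.
  apply: lee_wpmul2l; first by rewrite lee_fin powR_ge0.
  apply: ge0_subset_integral => //.
    exact: (measurableT_comp (measurable_poweR _) mf).
  by move=> x _; exact: poweR_ge0.
apply: le_trans (hardy_positive p1 (measurable_funS (measurable_itv _) DH mf) f0D).
rewrite integral_mkcond [leRHS]integral_mkcond le_eqVlt; apply/orP; left; apply/eqP.
apply: eq_integral => x _; rewrite !patchE !mem_setE !in_itv /= !andbT.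
have [x0|x0|x0] := ltgtP 0%R x => //.
  rewrite measure_upto ?integral_upto ?inver ?(ltW x0) //.
  by rewrite gt_eqF ?G_gt0.
have E0 : `]0%R, 0%R]%classic = set0 :> set R by rewrite set_itv_ge // bnd_simp ltxx.
by rewrite -x0 integral_upto // E0 integral_set0 mule0 poweR0r // gt_eqF.
Qed.

End weighted_hardy.

(** * Failure of boundedness, tested on indicators *)

Import HBNNSimple.

(** The integral of a nonnegative function is the supremum over the simple
    functions below it, and the indicator of A is one of these. *)
Lemma measure_le_integral d (T : measurableType d) (R : realType)
    (nu : {measure set T -> \bar R}) (D A : set T) (f : T -> \bar R) :
  measurable A -> A `<=` D -> (forall x, D x -> 0 <= f x) ->
  (forall x, A x -> 1 <= f x) -> nu A <= \int[nu]_(x in D) f x.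
Proof.
move=> mA AD f0 f1; rewrite integral_mkcond ge0_integralTE; last exact: erestrict_ge0.
rewrite -(sintegral_indic nu A); apply: ereal_sup_ubound.
exists (indic_nnsfun R mA) => //= x. rewrite -[mindic _ _ x]/(\1_A x) indicE patchE.
have [/[!inE] Ax|_] := boolP (x \in A); first by rewrite (mem_set (AD _ Ax)) f1.
by case: ifPn => // /[!inE]/f0.
Qed.

(** By Bernoulli's inequality, (u / v)^n is at least 1 + n (u / v - 1). *)
Lemma not_geometric_bound (R : realType) (u v : R) : (0 < v)%R -> (v < u)%R ->
  ~ exists A : R, forall n, (u ^+ n <= A * v ^+ n)%R.
Proof.
move=> v0 vu [A hA].
have uv : (1 < u / v)%R by rewrite ltr_pdivlMr // mul1r.
have h n : ((u / v) ^+ n <= A)%R.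
  by rewrite expr_div_n ler_pdivrMr ?exprn_gt0.
pose d := (u / v - 1)%R.
have d0 : (0 < d)%R by rewrite subr_gt0.
have bern n : (1 + d *+ n <= (u / v) ^+ n)%R.
  elim: n => [|n IHn]; first by rewrite mulr0n addr0 expr0.
  have dn0 : (0 <= d * (d *+ n))%R by rewrite mulr_ge0 ?mulrn_wge0 // ltW.
  have uv0 : (0 <= u / v)%R by apply: le_trans (ltW uv).
  rewrite exprS; apply: le_trans (ler_wpM2l uv0 IHn).
  have -> : (u / v = 1 + d)%R by rewrite /d addrC subrK.
  rewrite mulrSr; lra.
have A0 : (0 <= A)%R by apply: le_trans (h 0%N); rewrite expr0 ler01.
have := archi_boundP (divr_ge0 A0 (ltW d0)); set n := Num.bound _.
rewrite ltr_pdivrMr // mulr_natl => An.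
have := le_trans (bern n) (h n); lra.
Qed.

Section indicator_tests.
Variables (R : realType) (nu : {measure set (measurableTypeR R) -> \bar R}).

Lemma integral_indic_powR (p e : R) : (0 < p)%R ->
  \int[nu]_(x in `[0%R, +oo[%classic) (\1_(`[0%R, e]%classic) x : R)%:E `^ p =
  nu `[0%R, e]%classic.
Proof.
move=> p0.
transitivity (\int[nu]_(x in `[0%R, +oo[%classic) (\1_(`[0%R, e]%classic) x : R)%:E).
  apply: eq_integral => x _; rewrite indicE; case: (_ \in _) => /=.
    by rewrite powR1.
  by rewrite powR0 // gt_eqF.
rewrite integral_indic // setIidl //; exact: subset_itvl.
Qed.

Lemma integral_indic_upto (e x : R) : (x <= e)%R ->
  \int[nu]_(t in `[0%R, x]%classic) (\1_(`[0%R, e]%classic) t : R)%:E = nu `[0%R, x]%classic.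
Proof. by move=> xe; rewrite integral_indic // setIidr //; exact: subset_itvl. Qed.

End indicator_tests.

Lemma powR_exprV (R : realType) (a r : R) n : (0 < a)%R ->
  ((a ^- n) `^ r = (a^-1 `^ r) ^+ n)%R.
Proof.
move=> a0; have ai0 : (0 <= a^-1)%R by rewrite invr_ge0 ltW.
have h1 : (a^-1 ^+ n = a^-1 `^ n%:R)%R by rewrite powR_mulrn.
by rewrite -exprVn h1 powRAC powR_mulrn // powR_ge0.
Qed.

Lemma powR_lt_exp (R : realType) (a r s : R) : (0 < a)%R -> (a < 1)%R -> (r < s)%R ->
  (a `^ s < a `^ r)%R.
Proof.
move=> a0 a1 rs; have d0 : (0 < s - r)%R by rewrite subr_gt0.
have -> : (s = r + (s - r))%R by rewrite addrC subrK.
rewrite powRD; last by rewrite (gt_eqF a0) implybT.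
rewrite gtr_pMr ?powR_gt0 // -[ltRHS](congr1 (fun f => f (s - r)%R) (@powR1 R)).
by rewrite gt0_ltr_powR ?nnegrE ?ler01 ?ltW.
Qed.

Section unboundedness.
Variables (R : realType) (lam : {sigma_finite_measure set (measurableTypeR R) -> \bar R}).
Variable G : R -> R.
Hypothesis lamG : forall x : R, lam `]-oo, x]%classic = (G x)%:E.
Hypothesis G0 : G 0 = 0%R.
Hypothesis G_gt0 : forall x : R, (0 < x)%R -> (0 < G x)%R.
Hypothesis Gpow : forall n, G (3 ^- n) = (2 ^- n)%R.

(** In the applications S is the average of the indicator of [0, e], which is 1
    on ]0, e]; only this interval is kept on the left-hand side. *)
Let indicator_lower_bound (q e : R) (S : R -> \bar R) : (0 < q)%R -> (0 < e)%R ->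
  (forall x, (0 < x <= e)%R -> 1 <= S x) ->
  (G e `^ q^-1)%:E <= (\int[lam]_(x in `[0%R, +oo[%classic) (S x `^ q)) `^ q^-1.
Proof.
move=> q0 e0 S1.
rewrite -poweR_EFin -(measure_upto_open lamG G0 (ltW e0)).
apply: ge0_le_poweR; rewrite ?invr_ge0 ?(ltW q0) //.
apply: measure_le_integral => //.
- by apply: subset_itv; rewrite bnd_simp.
- by move=> x _; exact: poweR_ge0.
- move=> x /=; rewrite in_itv /= => /S1 h; rewrite -(poweR1r q).
  by apply: ge0_le_poweR h; rewrite ?(ltW q0).
Qed.

(** For the indicator of [0, 3^-n], the inequality becomes
    2^(-n/q) <= A * 2^(-n/p), where 1/q < 1/p. *)
Lemma not_bounded_Lp_Lq (p q : R) : (1 < p)%R -> (p < q)%R ->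
  ~ exists A : R, forall f : R -> R,
    measurable_fun (`[0%R, +oo[%classic : set R) f ->
    (forall x : R, (0 <= x)%R -> (0 <= f x)%R) ->
    (\int[lam]_(x in `[0%R, +oo[%classic)
       ((lam `[0%R, x]%classic)^-1 *
        \int[lam]_(t in `[0%R, x]%classic) (f t)%:E) `^ q) `^ q^-1
    <= A%:E * (\int[lam]_(x in `[0%R, +oo[%classic) (f x)%:E `^ p) `^ p^-1.
Proof.
move=> p1 pq [A hA].
have p0 : (0 < p)%R by exact: lt_trans p1.
have q0 : (0 < q)%R by exact: lt_trans pq.
apply: (@not_geometric_bound R (2^-1 `^ q^-1)%R (2^-1 `^ p^-1)%R).
- by rewrite powR_gt0 // invr_gt0.
- by apply: powR_lt_exp; rewrite ?invf_lt1 ?invr_gt0 ?ltr1n ?ltf_pV2.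
exists A => n; rewrite -!powR_exprV // -Gpow.
have e0 : (0 < 3 ^- n :> R)%R by rewrite invr_gt0 exprn_gt0.
set e : R := (3 ^- n)%R in e0 *.
have := hA (\1_(`[0%R, e]%classic)) _ _.
rewrite (eq_trans (integral_indic_powR lam e p0) (measure_upto lamG G0 (ltW e0))) => h.
rewrite -lee_fin EFinM; apply: le_trans (h _ _); last 2 first.
- exact: measurable_funTS (measurable_indic _).
- by move=> x _; rewrite indicE.
apply: indicator_lower_bound => //.
move=> x /andP[x0 xe].
rewrite (eq_trans (integral_indic_upto lam xe) (measure_upto lamG G0 (ltW x0))).
rewrite (measure_upto lamG G0 (ltW x0)).
by rewrite inver gt_eqF ?G_gt0 // -EFinM mulVf // gt_eqF // G_gt0.
Qed.

(** For the indicator of [0, 3^-n], the inequality becomes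
    2^(-n/q) <= A * 3^(-n/p), where 3^(-1/p) < 2^(-1/p) <= 2^(-1/q). *)
Lemma not_bounded_Lebesgue_Lp_Lq (p q : R) : (1 < p)%R -> (p <= q)%R ->
  ~ exists A : R, forall f : R -> R,
    measurable_fun (`[0%R, +oo[%classic : set R) f ->
    (forall x : R, (0 <= x)%R -> (0 <= f x)%R) ->
    (\int[lam]_(x in `[0%R, +oo[%classic)
       ((x^-1)%:E * \int[@lebesgue_measure R]_(t in `[0%R, x]%classic) (f t)%:E) `^ q) `^ q^-1
    <= A%:E * (\int[@lebesgue_measure R]_(x in `[0%R, +oo[%classic) (f x)%:E `^ p) `^ p^-1.
Proof.
move=> p1 pq [A hA].
have p0 : (0 < p)%R by exact: lt_trans p1.
have q0 : (0 < q)%R by exact: lt_le_trans pq.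
have leb x : (0 <= x)%R -> lebesgue_measure (`[0%R, x]%classic : set R) = x%:E.
  rewrite le_eqVlt => /orP[/eqP <-|x0]; rewrite lebesgue_measure_itv /= lte_fin ?ltxx //.
  by rewrite x0 sube0.
apply: (@not_geometric_bound R (2^-1 `^ q^-1)%R (3^-1 `^ p^-1)%R).
- by rewrite powR_gt0 // invr_gt0.
- apply: (@lt_le_trans _ _ (2^-1 `^ p^-1)%R).
    by rewrite gt0_ltr_powR ?invr_gt0 ?nnegrE ?invr_ge0 // ltf_pV2 ?posrE // ltr_nat.
  apply: ger_powR; last by rewrite lef_pV2 ?posrE.
  by rewrite invr_gt0 ltr0n invf_le1 ?ler1n.
exists A => n; rewrite -!powR_exprV // -Gpow.
have e0 : (0 < 3 ^- n :> R)%R by rewrite invr_gt0 exprn_gt0.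
set e : R := (3 ^- n)%R in e0 *.
have := hA (\1_(`[0%R, e]%classic)) _ _.
rewrite (eq_trans (integral_indic_powR lebesgue_measure e p0) (leb _ (ltW e0))) => h.
rewrite -lee_fin EFinM; apply: le_trans (h _ _); last 2 first.
- exact: measurable_funTS (measurable_indic _).
- by move=> x _; rewrite indicE.
apply: indicator_lower_bound => //.
move=> x /andP[x0 xe].
rewrite (eq_trans (integral_indic_upto lebesgue_measure xe) (leb _ (ltW x0))).
by rewrite -EFinM mulVf // gt_eqF.
Qed.

End unboundedness.

(** * The Bernoulli measure on the half-line *)

Section Bernoulli_extension.
Variables (R : realType) (mu : probability (measurableTypeR R) R).
Hypothesis Hmu : standard_Bernoulli mu.
Local Notation F := (Bernoulli_cdf mu).

(** The translates by n >= N are carried by [N, +oo[ and do not meet the ray. *)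
Lemma Bernoulli_ext_ray (N : nat) (x : R) : (x < N%:R)%R ->
  Bernoulli_ext mu `]-oo, x]%classic = (\sum_(n < N) F (x - n%:R))%R%:E.
Proof.
move=> xN; rewrite /Bernoulli_ext /= /mseries.
have E n : distribution mu (@shift_right R n) `]-oo, x]%classic = (F (x - n%:R))%:E.
  rewrite Bernoulli_cdfE /distribution /pushforward; congr (mu _).
  by apply/seteqP; split => t /=; rewrite !in_itv /= /shift_right lerBrDr.
transitivity (\sum_(0 <= n <oo) (F (x - n%:R))%:E).
  by apply: eq_eseriesr => n _; exact: E.
rewrite (@nneseries_split _ _ 0 N); last by move=> k _; rewrite lee_fin Bernoulli_cdf_ge0.
rewrite eseries0 ?adde0 ?add0n; last first.
  move=> k Nk _; rewrite (Bernoulli_cdf_lt0 Hmu) // subr_lt0.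
  by apply: lt_le_trans xN _; rewrite ler_nat.
by rewrite sumEFin big_mkord.
Qed.

Definition Bernoulli_ext_cdf (x : R) : R := fine (Bernoulli_ext mu `]-oo, x]%classic).
Local Notation G := Bernoulli_ext_cdf.

Lemma Bernoulli_ext_cdf_sum (N : nat) (x : R) : (x < N%:R)%R ->
  G x = (\sum_(n < N) F (x - n%:R))%R.
Proof. by move=> xN; rewrite /G (Bernoulli_ext_ray xN). Qed.

Let exists_nat_gt (x : R) : exists N : nat, (x < N%:R)%R.
Proof.
by exists (Num.bound `|x|%R); apply: le_lt_trans (ler_norm x) (archi_boundP _).
Qed.

Lemma Bernoulli_ext_cdfE (x : R) : Bernoulli_ext mu `]-oo, x]%classic = (G x)%:E.
Proof. by have [N xN] := exists_nat_gt x; rewrite /G (Bernoulli_ext_ray xN). Qed.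

Lemma continuous_Bernoulli_ext_cdf : continuous G.
Proof.
move=> x; have [N xN] := exists_nat_gt x.
have cS : {for x, continuous (fun y : R => \sum_(n < N) F (y - n%:R))%R}.
  elim: (N) => [|M IHM].
    rewrite (_ : (fun _ => _) = cst 0%R); first exact: cst_continuous.
    by apply/funext => y; rewrite big_ord0.
  rewrite (_ : (fun _ => _) = (fun y : R => \sum_(n < M) F (y - n%:R) + F (y - M%:R)))%R.
    apply: cvgD; first exact: IHM.
    apply: (@continuous_comp _ _ _ (fun y : R => y - M%:R)%R F).
      by apply: cvgB; [exact: cvg_id|exact: cvg_cst].
    exact: (continuous_Bernoulli_cdf Hmu).
  by apply/funext => y; rewrite big_ord_recr.
rewrite /continuous_at (Bernoulli_ext_cdf_sum xN).
apply: cvg_trans cS; apply: near_eq_cvg; near=> y.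
rewrite (@Bernoulli_ext_cdf_sum N) //; near: y; exact: lt_nbhsl.
Unshelve. all: by end_near. Qed.

(** The second copy of the Cantor set meets ]-oo, 1] only in its left end
    point, which has no mass. *)
Lemma Bernoulli_ext_cdf_small (x : R) : (x <= 1)%R -> G x = F x.
Proof.
move=> x1; rewrite (@Bernoulli_ext_cdf_sum 2); last by lra.
rewrite !big_ord_recl big_ord0 /= addr0 subr0.
suff -> : F (x - 1) = 0%R by rewrite addr0.
apply/eqP; rewrite eq_le Bernoulli_cdf_ge0 -(Bernoulli_cdf_at0 Hmu).
by rewrite Bernoulli_cdf_nd //; lra.
Qed.

Lemma Bernoulli_ext_cdf_0 : G 0 = 0%R.
Proof. by rewrite Bernoulli_ext_cdf_small ?ler01 // Bernoulli_cdf_at0. Qed.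

Lemma Bernoulli_ext_cdf_pow3 m : G (3 ^- m) = (2 ^- m)%R.
Proof.
rewrite Bernoulli_ext_cdf_small ?Bernoulli_cdf_pow3 //.
by rewrite invf_le1 ?exprn_gt0 // exprn_ege1 // ler1n.
Qed.

Lemma Bernoulli_ext_cdf_gt0 (x : R) : (0 < x)%R -> (0 < G x)%R.
Proof.
move=> x0; have [m mx] : exists m, (3 ^- m <= x)%R.
  have [m mx] := exists_pow2_lt x0; exists m; apply: le_trans (ltW mx).
  by rewrite lef_pV2 ?posrE ?exprn_gt0 // lerXn2r ?nnegrE // ler_nat.
apply: (@lt_le_trans _ _ (G (3 ^- m))).
  by rewrite Bernoulli_ext_cdf_pow3 invr_gt0 exprn_gt0.
exact: (distribution_function_nd Bernoulli_ext_cdfE).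
Qed.

Lemma Bernoulli_ext_cdf_unbounded (s : R) : exists x, (s <= G x)%R.
Proof.
have [N sN] := exists_nat_gt s; exists N%:R.
(* N copies of mass 1 lie to the left of N; the next one starts at N, so that
   the sum has N.+1 terms *)
rewrite (@Bernoulli_ext_cdf_sum N.+1) ?ltr_nat //.
rewrite big_ord_recr /=; apply: (@le_trans _ _ (\sum_(n < N) 1)%R).
  by rewrite sumr_const card_ord ltW.
rewrite -[leLHS]addr0 lerD ?Bernoulli_cdf_ge0 // ler_sum // => n _.
by rewrite (Bernoulli_cdf_ge1 Hmu) // lerBrDr addrC natr1 ler_nat ltn_ord.
Qed.

Lemma sigma_finite_Bernoulli_ext : sigma_finite setT (Bernoulli_ext mu).
Proof.
exists (fun n : nat => `]-oo, n%:R]%classic).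
  apply/esym; rewrite -subTset => x _; have [N xN] := exists_nat_gt x.
  by exists N => //=; rewrite in_itv /= ltW.
by move=> n; split; [exact: measurable_itv|rewrite Bernoulli_ext_cdfE ltry].
Qed.

End Bernoulli_extension.

Theorem corollary1p2 (R : realType) (mu : probability (measurableTypeR R) R)
    (Hmu : standard_Bernoulli mu) :
  let lambda := Bernoulli_ext mu in
  let halfline : set R := `[(0 : R)%R, +oo[%classic in
  let upto (x : R) : set R := `[(0 : R)%R, x]%classic in
  (forall (p : R) (f : R -> \bar R),
     (1 < p)%R ->
     measurable_fun halfline f ->
     (forall x : R, (0 <= x)%R -> 0 <= f x) ->
     \int[lambda]_(x in halfline)
        ((lambda (upto x))^-1 * \int[lambda]_(t in upto x) f t) `^ p
     <= ((p / (p - 1)) `^ p)%:E * \int[lambda]_(x in halfline) (f x) `^ p)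
  /\
  (forall p q : R, (1 < p)%R -> (p < q)%R ->
     ~ exists A : R, forall f : R -> R,
       measurable_fun halfline f ->
       (forall x : R, (0 <= x)%R -> (0 <= f x)%R) ->
       (\int[lambda]_(x in halfline)
          ((lambda (upto x))^-1 *
           \int[lambda]_(t in upto x) (f t)%:E) `^ q) `^ q^-1
       <= A%:E * (\int[lambda]_(x in halfline) (f x)%:E `^ p) `^ p^-1)
  /\
  (forall p q : R, (1 < p)%R -> (p <= q)%R ->
     ~ exists A : R, forall f : R -> R,
       measurable_fun halfline f ->
       (forall x : R, (0 <= x)%R -> (0 <= f x)%R) ->
       (\int[lambda]_(x in halfline)
          ((x^-1)%:E *
           \int[@lebesgue_measure R]_(t in upto x) (f t)%:E) `^ q) `^ q^-1
       <= A%:E *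
          (\int[@lebesgue_measure R]_(x in halfline) (f x)%:E `^ p) `^ p^-1).
Proof.
move=> lambda halfline upto.
pose lam : {sigma_finite_measure set (measurableTypeR R) -> \bar R} :=
  HB.pack (Bernoulli_ext mu)
    (Measure_isSigmaFinite.Build _ _ _ (Bernoulli_ext mu) (sigma_finite_Bernoulli_ext Hmu)).
have lamG : forall x : R, lam `]-oo, x]%classic = (Bernoulli_ext_cdf mu x)%:E.
  exact: Bernoulli_ext_cdfE.
have G0 := Bernoulli_ext_cdf_0 Hmu.
have Ggt0 := Bernoulli_ext_cdf_gt0 Hmu.
have Gpow := Bernoulli_ext_cdf_pow3 Hmu.
split; [|split].
- move=> p f p1 mf f0.
  exact: (hardy_halfline lamG (continuous_Bernoulli_ext_cdf Hmu) G0
    (Bernoulli_ext_cdf_unbounded Hmu) Ggt0 p1 mf f0).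
- move=> p q p1 pq; exact: (not_bounded_Lp_Lq lamG G0 Ggt0 Gpow p1 pq).
- move=> p q p1 pq; exact: (not_bounded_Lebesgue_Lp_Lq lamG G0 Gpow p1 pq).
Qed.
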